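(* Let $\lambda$ be a probability measure on the unit disk $\mathbb{D}$ which is invariant under $z\mapsto -z$, i.e. $d\lambda(z)=d\lambda(-z)$. Then the affine transformation $A_\lambda$ associated to $\lambda$ is the identity map: $A_\lambda(z)=z$.
   Context: For $\delta>0$, independently assign to each cell of the square grid $\delta\mathbb{Z}^2$ (the tiling of $\mathbb{C}$ by squares of side $\delta$ with vertices in $\delta\mathbb{Z}^2$) a random complex number in $\mathbb{D}$ with law $\lambda$, and let $\mu$ be the resulting Beltrami coefficient, constant on cells. Let $w^\mu$ be the homeomorphism of $\mathbb{C}$ which is quasiconformal on each bounded set, solves $\overline{\partial}w=\mu\,\partial w$ a.e. and fixes $0,1,\infty$ (it exists and is unique almost surely). The affine transformation $A_\lambda$ is the (unique) real-affine map $\mathbb{C}\to\mathbb{C}$, of the form $A_\lambda=w^{\mu_\lambda}$ for a constant $\mu_\lambda\in\mathbb{D}$ (so it fixes $0$ and $1$), with the property that for every compact $K\subset\mathbb{C}$ and $\varepsilon>0$, for all sufficiently small $\delta$, $\|w^\mu-A_\lambda\|_{C(K)}<\varepsilon$ holds with probability at least $1-\varepsilon$. The existence of $A_\lambda$ for every probability measure $\lambda$ on $\mathbb{D}$ is a theorem and may be assumed. *)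

(* Defs.v *)
From HB Require Import structures.
From mathcomp Require Import all_boot all_order all_algebra.
From mathcomp Require Import all_classical all_reals all_analysis.
From mathcomp Require Import complex.
Import Order.TTheory GRing.Theory Num.Theory.
Import numFieldNormedType.Exports ComplexField.Normc.

Set Implicit Arguments.
Unset Strict Implicit.
Unset Printing Implicit Defensive.

Local Open Scope classical_set_scope.
Local Open Scope ring_scope.
Local Open Scope complex_scope.

(* The plane is R[i], with the topology of its norm; [normc] is the modulus
   with values in R (the generic norm of R[i] takes its values in R[i]). *)

HB.instance Definition _ (R : realType) := NormedModule.copy R[i] R[i]^o.

(* Almost every point of the plane, for two-dimensional Lebesgue measure. *)
Definition ae_plane (R : realType) (Q : R[i] -> Prop) : Prop :=
  {ae ((@lebesgue_measure R) \x (@lebesgue_measure R))%E,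
     forall p : R * R, Q (p.1 +i* p.2)}.

Definition dx (R : realType) (w : R[i] -> R[i]) (z : R[i]) : R[i] :=
  derive1 (fun t => complex.Re (w (t +i* complex.Im z))) (complex.Re z) +i*
  derive1 (fun t => complex.Im (w (t +i* complex.Im z))) (complex.Re z).

Definition dy (R : realType) (w : R[i] -> R[i]) (z : R[i]) : R[i] :=
  derive1 (fun t => complex.Re (w (complex.Re z +i* t))) (complex.Im z) +i*
  derive1 (fun t => complex.Im (w (complex.Re z +i* t))) (complex.Im z).

Definition has_partials (R : realType) (w : R[i] -> R[i]) (z : R[i]) : Prop :=
  [/\ derivable (fun t => complex.Re (w (t +i* complex.Im z))) (complex.Re z) 1,
      derivable (fun t => complex.Im (w (t +i* complex.Im z))) (complex.Re z) 1,
      derivable (fun t => complex.Re (w (complex.Re z +i* t))) (complex.Im z) 1 &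
      derivable (fun t => complex.Im (w (complex.Re z +i* t))) (complex.Im z) 1].

Definition dz (R : realType) (w : R[i] -> R[i]) (z : R[i]) : R[i] :=
  (dx w z - 'i%C * dy w z) / 2.

Definition dzbar (R : realType) (w : R[i] -> R[i]) (z : R[i]) : R[i] :=
  (dx w z + 'i%C * dy w z) / 2.

Definition abs_continuous (R : realType) (a b : R) (f : R -> R[i]) : Prop :=
  forall e : R, 0 < e -> exists2 d : R, 0 < d &
    forall s : seq (R * R),
      all (fun p => [&& a <= p.1, p.1 <= p.2 & p.2 <= b]) s ->
      pairwise (fun p q => (p.2 <= q.1) || (q.2 <= p.1)) s ->
      \sum_(p <- s) (p.2 - p.1) < d ->
      \sum_(p <- s) normc (f p.2 - f p.1) < e.

(* Absolute continuity on lines: in every closed rectangle contained in U, w is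
   absolutely continuous on almost every horizontal and vertical segment. *)
Definition ACL (R : realType) (U : set R[i]) (w : R[i] -> R[i]) : Prop :=
  forall a b c d : R, a < b -> c < d ->
    (forall x y, a <= x <= b -> c <= y <= d -> U (x +i* y)) ->
    {ae (@lebesgue_measure R), forall y : R, c <= y <= d ->
       abs_continuous a b (fun x => w (x +i* y))} /\
    {ae (@lebesgue_measure R), forall x : R, a <= x <= b ->
       abs_continuous c d (fun y => w (x +i* y))}.

Definition homeomorphism (R : realType) (w : R[i] -> R[i]) : Prop :=
  exists v : R[i] -> R[i],
    [/\ continuous w, continuous v, cancel w v & cancel v w].

(* The analytic definition of quasiconformality on the open set U, for w already
   known to be a homeomorphism; the dilatation bound k < 1 depends on U. *)
Definition quasiconformal_on (R : realType) (U : set R[i])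
    (w : R[i] -> R[i]) : Prop :=
  ACL U w /\
  exists2 k : R, 0 <= k < 1 &
    ae_plane (fun z => U z ->
      has_partials w z /\ normc (dzbar w z) <= k * normc (dz w z)).

(* A homeomorphism of the plane onto itself extends to the Riemann sphere by
   fixing infinity, so the normalisation at infinity is automatic. *)
Definition normalized_solution (R : realType) (mu : R[i] -> R[i])
    (w : R[i] -> R[i]) : Prop :=
  [/\ homeomorphism w,
      forall U : set R[i], open U -> (exists M : R, forall z, U z -> normc z <= M) ->
        quasiconformal_on U w,
      ae_plane (fun z => dzbar w z = mu z * dz w z),
      w 0 = 0 &
      w 1 = 1].

(* [is_wmu mu w]: the map w^mu is well defined, and it is w. *)
Definition is_wmu (R : realType) (mu : R[i] -> R[i]) (w : R[i] -> R[i]) : Prop :=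
  normalized_solution mu w /\
  forall w', normalized_solution mu w' -> w' = w.

Definition disk (R : realType) : Type := {z : R[i] | normc z < 1}.

HB.instance Definition _ (R : realType) := Choice.on (disk R).

Lemma disk0_subproof (R : realType) : normc (0 : R[i]) < 1.
Proof. by rewrite normc0. Qed.

HB.instance Definition _ (R : realType) :=
  isPointed.Build (disk R) (exist _ 0 (@disk0_subproof R)).

Lemma disk_opp_subproof (R : realType) (z : disk R) : normc (- sval z) < 1.
Proof. by rewrite normcN; case: z. Qed.

Definition disk_opp (R : realType) (z : disk R) : disk R :=
  exist _ (- sval z) (disk_opp_subproof z).

(* The open subsets of the disk are the traces of the open subsets of the plane. *)
Definition borel_disk (R : realType) :=
  g_sigma_algebraType [set [set z : disk R | U (sval z)] | U in @open R[i]].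

(* The cell (m, n) of the grid of mesh delta is
   [m delta, (m+1) delta[ x [n delta, (n+1) delta[. *)
Definition cell : Type := (int * int)%type.

Definition cell_of (R : realType) (delta : R) (z : R[i]) : cell :=
  (Num.floor (complex.Re z / delta), Num.floor (complex.Im z / delta)).

(* The values attached to the cells, with the product sigma-algebra. *)
Definition config (R : realType) :=
  g_sigma_algebraType
    [set C : set (cell -> borel_disk R) |
       exists c (B : set (borel_disk R)),
         measurable B /\ C = [set omega | B (omega c)]].

Definition grid_coef (R : realType) (delta : R) (omega : config R)
    (z : R[i]) : R[i] :=
  sval (omega (cell_of delta z)).

(* P is the product of copies of lambda over the cells, i.e. under P the values
   on the cells are independent with law lambda; this determines P. *)
Definition iid_law (R : realType) (lambda : probability (borel_disk R) R)
    (P : probability (config R) R) : Prop :=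
  forall (F : seq cell) (B : cell -> set (borel_disk R)),
    uniq F -> (forall c, measurable (B c)) ->
    P [set omega | forall c, c \in F -> B c (omega c)] =
    (\prod_(c <- F) lambda (B c))%E.

Definition real_affine (R : realType) (A : R[i] -> R[i]) : Prop :=
  exists a b c : R[i], forall z, A z = a * z + b * z^* + c.

(* [is_A_lambda lambda A]: the affine map associated with lambda is A.  The
   measure P exists and is unique.  "With probability at least 1 - e" means that
   the event contains a measurable set of that probability; the event includes
   that w^mu is well defined, which holds almost surely. *)
Definition is_A_lambda (R : realType) (lambda : probability (borel_disk R) R)
    (A : R[i] -> R[i]) : Prop :=
  [/\ real_affine A,
      (exists2 m : R[i], normc m < 1 & is_wmu (fun=> m) A) &
      exists2 P : probability (config R) R, iid_law lambda P &
        forall (K : set R[i]) (e : R), compact K -> 0 < e ->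
          \forall delta \near 0^'+,
            exists E : set (config R),
              [/\ measurable E, ((1 - e)%:E <= P E)%E &
                forall omega, E omega ->
                  exists2 w, is_wmu (grid_coef delta omega) w &
                    sup [set normc (w z - A z) | z in K] < e]].

(* Main.v *)
(* The symmetry used is the quarter turn of the grid. If w solves the Beltrami
   equation for mu, then W z = w (i z) / w i is the normalized solution for
   - mu (i z), since a rotation by i multiplies the coefficient by conj i / i = -1.
   As lambda is symmetric, - mu (i z) is again an i.i.d. coefficient on the same
   grid, so with positive probability w and W are both close to A. At the point i
   this says that w i, w (-1) and w (-1) / w i are close to A i, A (-1) and A i,
   whence (A i)^2 = A (-1) = -1. An affine map fixing 0 and 1 with A i = i or
   A i = -i is the identity or the conjugation, and the conjugation solves no
   Beltrami equation. *)

Require Import Defs.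
From mathcomp Require Import all_boot all_order all_algebra.
From mathcomp Require Import all_classical all_reals all_analysis.
From mathcomp Require Import complex.
From mathcomp Require Import ring lra zify.
Import Order.TTheory GRing.Theory Num.Theory.
Import numFieldNormedType.Exports ComplexField.Normc.

Set Implicit Arguments.
Unset Strict Implicit.
Unset Printing Implicit Defensive.

Local Open Scope classical_set_scope.
Local Open Scope ring_scope.
Local Open Scope complex_scope.

(** * Rotating a quasiconformal map by a quarter turn *)

Lemma mulic (R : realType) (x y : R) : 'i%C * (x +i* y) = (- y) +i* x.
Proof. by apply/eqP; rewrite eq_complex /= !mul0r !mul1r sub0r add0r !eqxx. Qed.

(** Differentiation of a plane curve over the reals, component by component, matching [dx] and [dy].
    Bundling the value [d] lets both components be transported at once. *)
Definition is_curve_derive (R : realType) (g : R -> R[i]) (t : R) (d : R[i]) : Prop :=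
  is_derive t (1 : R) (fun s => complex.Re (g s)) (complex.Re d) /\
  is_derive t (1 : R) (fun s => complex.Im (g s)) (complex.Im d).

Lemma is_curve_deriveM (R : realType) (g : R -> R[i]) (t : R) (d k : R[i]) :
  is_curve_derive g t d -> is_curve_derive (fun s => g s * k) t (d * k).
Proof.
(* Multiplication by a fixed complex number is real-linear in the two components; the coefficients
   are written as scalings so that [is_deriveZ] applies. *)
have ReM (u v : R[i]) : complex.Re (u * v) =
    complex.Re v *: complex.Re u - complex.Im v *: complex.Im u :> R.
  by rewrite /GRing.scale /=; case: u v => a b [c d'] /=; ring.
have ImM (u v : R[i]) : complex.Im (u * v) =
    complex.Im v *: complex.Re u + complex.Re v *: complex.Im u :> R.
  by rewrite /GRing.scale /=; case: u v => a b [c d'] /=; ring.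
move=> [dr di]; split.
- rewrite ReM; under eq_fun do rewrite ReM.
  exact: (is_deriveB (is_deriveZ _ dr) (is_deriveZ _ di)).
- rewrite ImM; under eq_fun do rewrite ImM.
  exact: (is_deriveD (is_deriveZ _ dr) (is_deriveZ _ di)).
Qed.

Lemma is_curve_deriveN (R : realType) (g : R -> R[i]) (t : R) (d : R[i]) :
  is_curve_derive g (- t) d -> is_curve_derive (fun s => g (- s)) t (- d).
Proof.
have hN (f : R -> R) df : is_derive (- t) (1 : R) f df ->
    is_derive t (1 : R) (fun s => f (- s)) (- df).
  move=> hf; rewrite (_ : (fun _ => _) = f \o -%R) //.
  have := @is_derive1_comp R f -%R t df (-1) hf.
  by rewrite mulrN1; apply; exact: is_deriveNid.
by case: d => x y [/hN ? /hN ?].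
Qed.

(** [derive1] is total, so [dx] and [dy] always have values; the partials exist exactly when these
    values are genuine derivatives. *)
Lemma has_partialsP (R : realType) (w : R[i] -> R[i]) (z : R[i]) :
  has_partials w z <->
  is_curve_derive (fun t => w (t +i* complex.Im z)) (complex.Re z) (dx w z) /\
  is_curve_derive (fun t => w (complex.Re z +i* t)) (complex.Im z) (dy w z).
Proof.
split.
  case=> h1 h2 h3 h4; split; split; rewrite /= derive1E.
  - by apply/derivableP; exact: h1.
  - by apply/derivableP; exact: h2.
  - by apply/derivableP; exact: h3.
  - by apply/derivableP; exact: h4.
by case=> -[? ?] [? ?]; split.
Qed.

Lemma dxE (R : realType) (w : R[i] -> R[i]) (z d : R[i]) :
  is_curve_derive (fun t => w (t +i* complex.Im z)) (complex.Re z) d -> dx w z = d.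
Proof. by case: d => a b [h1 h2]; rewrite /dx !derive1E !derive_val. Qed.

Lemma dyE (R : realType) (w : R[i] -> R[i]) (z d : R[i]) :
  is_curve_derive (fun t => w (complex.Re z +i* t)) (complex.Im z) d -> dy w z = d.
Proof. by case: d => a b [h1 h2]; rewrite /dy !derive1E !derive_val. Qed.

Section rotated_map.
Variables (R : realType) (w : R[i] -> R[i]).

Definition rotated (z : R[i]) : R[i] := w ('i%C * z) * (w 'i%C)^-1.

(** As i (x + i y) = - y + i x, moving [z] to the right moves [i z] upwards, and moving [z] upwards
    moves [i z] to the left; hence the exchange of partials and the sign. *)
Lemma rotated_partials (z : R[i]) : has_partials w ('i%C * z) ->
  [/\ has_partials rotated z,
      dx rotated z = dy w ('i%C * z) * (w 'i%C)^-1 &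
      dy rotated z = - dx w ('i%C * z) * (w 'i%C)^-1].
Proof.
case: z => x y /has_partialsP; rewrite mulic /= => -[hx hy].
have dX : is_curve_derive (fun t => rotated (t +i* y)) x
    (dy w (- y +i* x) * (w 'i%C)^-1).
  under eq_fun do rewrite /rotated mulic.
  exact: is_curve_deriveM.
have dY : is_curve_derive (fun t => rotated (x +i* t)) y
    (- dx w (- y +i* x) * (w 'i%C)^-1).
  under eq_fun do rewrite /rotated mulic.
  apply: is_curve_deriveM.
  exact: (@is_curve_deriveN _ (fun s => w (s +i* x)) y _ hx).
have eX := @dxE _ rotated (x +i* y) _ dX.
have eY := @dyE _ rotated (x +i* y) _ dY.
by split => //; apply/has_partialsP; rewrite eX eY.
Qed.

(** The factor is i here and its conjugate - i for [dzbar]; their quotient - 1 is the sign change of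
    the Beltrami coefficient. *)
Lemma rotated_dz (z : R[i]) : has_partials w ('i%C * z) ->
  dz rotated z = 'i%C * dz w ('i%C * z) * (w 'i%C)^-1.
Proof.
move=> /rotated_partials[_ eX eY]; rewrite /dz eX eY.
(* The imaginary unit becomes a variable [j] known only through its square, and [ring] computes
   modulo that equation. *)
have := @sqr_i R; move: ('i%C : R[i]) (_^-1) (dx _ _) (dy _ _) => j k a b hj.
by ring: hj.
Qed.

Lemma rotated_dzbar (z : R[i]) : has_partials w ('i%C * z) ->
  dzbar rotated z = - 'i%C * dzbar w ('i%C * z) * (w 'i%C)^-1.
Proof.
move=> /rotated_partials[_ eX eY]; rewrite /dzbar eX eY.
have := @sqr_i R; move: ('i%C : R[i]) (_^-1) (dx _ _) (dy _ _) => j k a b hj.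
by ring: hj.
Qed.

End rotated_map.

(** * Null sets under reflection and quarter turn *)

Lemma ae_comp d (T : measurableType d) (R : realType) (mu : set T -> \bar R)
    (f : T -> T) (P : T -> Prop) :
  measurable_fun setT f ->
  (forall A, measurable A -> mu (f @^-1` A) = mu A) ->
  (\forall x \ae mu, P x) -> \forall x \ae mu, P (f x).
Proof.
move=> mf muf [A [mA A0 PA]]; exists (f @^-1` A); split.
- by rewrite -[X in measurable X]setTI; exact: mf.
- by rewrite muf.
- by move=> x /= nP; exact: PA.
Qed.

Lemma ae_lebesgueN (R : realType) (P : R -> Prop) :
  {ae (@lebesgue_measure R), forall x, P x} ->
  {ae (@lebesgue_measure R), forall x, P (- x)}.
Proof.
apply: (@ae_comp _ (measurableTypeR R) R (@lebesgue_measure R) -%R).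
- exact: measurable_realfun.oppr_measurable.
- by move=> A mA; exact: lebesgue_measureN.
Qed.

(** The quarter turn preserves planar measure: on a rectangle it swaps the sides and reflects one of
    them, and a measure with the product values on rectangles is the product measure. *)
Lemma ae_plane_rotate (R : realType) (Q : R[i] -> Prop) :
  ae_plane Q -> ae_plane (fun z => Q ('i%C * z)).
Proof.
pose f (p : measurableTypeR R * measurableTypeR R) :
  measurableTypeR R * measurableTypeR R := (- p.2, p.1).
have mf : measurable_fun setT f.
  apply: measurable_fun_pair => //.
  by apply: measurableT_comp => //; exact: measurable_realfun.oppr_measurable.
pose mu := @lebesgue_measure R.
have muf A : measurable A -> (mu \x mu)%E (f @^-1` A) = (mu \x mu)%E A.
  move=> mA; apply/esym.
  apply: (@product_measure_unique _ _ _ _ R mu mu (pushforward (mu \x mu)%E f)).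
  - move=> B C mB mC; rewrite /= /pushforward.
    have -> : f @^-1` (B `*` C) = C `*` (-%R @^-1` B).
      by apply/seteqP; split => -[x y] /= [].
    rewrite product_measure1E //.
      by rewrite muleC; congr (_ * _)%E; exact: lebesgue_measureN.
    rewrite -[X in measurable X]setTI.
    exact: (measurable_realfun.oppr_measurable measurableT).
  - exact: mA.
move=> hQ; have := ae_comp mf muf hQ; apply: filterS => p /=.
by rewrite mulic.
Qed.

(** Meant for the horizontal grid lines, where the half-open cells are not respected by the
    rotation. *)
Lemma ae_plane_Im_notin (R : realType) (S : set R) : countable S ->
  ae_plane (fun z => ~ S (complex.Im z)).
Proof.
move=> cS; exists (setT `*` S).
have mS : measurable (S : set (measurableTypeR R)) by exact: countable_measurable.
split.
- exact: measurableX.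
- by rewrite product_measure1E // [X in (_ * X)%E](countable_lebesgue_measure0 cS) mule0.
- by move=> [x y] /= /contrapT.
Qed.

(** * Absolute continuity and quasiconformality under the quarter turn *)

Lemma normc_ge0 (R : realType) (z : R[i]) : 0 <= normc z.
Proof. by case: z => x y; exact: sqrtr_ge0. Qed.

Lemma normci (R : realType) : normc 'i%C = 1 :> R.
Proof. by rewrite /= expr0n expr1n add0r sqrtr1. Qed.

Lemma abs_continuousM (R : realType) (a b : R) (f : R -> R[i]) (k : R[i]) :
  abs_continuous a b f -> abs_continuous a b (fun t => f t * k).
Proof.
move=> hf e e0.
(* The added 1 keeps the divisor of [e] positive when [k] is zero. *)
have k0 : 0 < normc k + 1.
  by rewrite ltr_wpDl // normc_ge0.
have [d d0 hd] := hf (e / (normc k + 1)) (divr_gt0 e0 k0).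
exists d => // s s1 s2 s3; have := hd s s1 s2 s3.
rewrite ltr_pdivlMr // => /le_lt_trans; apply.
rewrite mulr_suml; apply: ler_sum => p _.
by rewrite -mulrBl normcM ler_wpM2l ?normc_ge0 // lerDl.
Qed.

Lemma abs_continuousN (R : realType) (a b : R) (f : R -> R[i]) :
  abs_continuous (- b) (- a) f -> abs_continuous a b (fun t => f (- t)).
Proof.
move=> hf e /hf[d d0 hd]; exists d => // s s1 s2 s3.
(* Reflecting an interval swaps its endpoints; lengths and non-overlapping are preserved. *)
pose r (p : R * R) := (- p.2, - p.1).
have := hd (map r s); rewrite all_map pairwise_map !big_map /=.
under eq_bigr do rewrite opprK addrC.
under [X in _ -> _ -> _ -> X < e]eq_bigr do rewrite -normcN opprB.
apply => //.
- apply: sub_all s1 => -[x y] /= /and3P[h1 h2 h3].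
  by rewrite !lerN2 h1 h2 h3.
- apply: sub_pairwise s2 => -[x y] [u v] /=.
  by rewrite !lerN2 orbC.
Qed.

(** The set of [z] with - i z in [U] is i U. Horizontal segments of [rotated w] are vertical
    segments of [w] at the reflected abscissa, and vertical ones are horizontal segments of [w] run
    backwards. *)
Lemma ACL_rotated (R : realType) (U : set R[i]) (w : R[i] -> R[i]) :
  ACL [set z | U (- 'i%C * z)] w -> ACL U (rotated w).
Proof.
move=> hw a b c d ab cd hU.
have dc : - d < - c by rewrite ltrN2.
have hU' x y : - d <= x <= - c -> a <= y <= b -> [set z | U (- 'i%C * z)] (x +i* y).
  move=> hx hy; rewrite /= mulNr mulic.
  suff : U (y +i* - x) by congr U; rewrite /= /GRing.opp /= opprK.
  by apply: hU => //; rewrite lerNr lerNl andbC.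
have [h1 h2] := hw _ _ _ _ dc ab hU'; split.
- move/ae_lebesgueN: h2.
  apply: (@filterS _ _ (ae_filter_ringOfSetsType (@lebesgue_measure R))) => y + hy.
  have -> : (fun x => rotated w (x +i* y)) = (fun x => w (- y +i* x) * (w 'i%C)^-1).
    by apply/funext => x; rewrite /rotated mulic.
  by move=> h; apply/abs_continuousM/h; rewrite !lerN2 andbC.
- move: h1.
  apply: (@filterS _ _ (ae_filter_ringOfSetsType (@lebesgue_measure R))) => x + hx.
  have -> : (fun y => rotated w (x +i* y)) = (fun y => w (- y +i* x) * (w 'i%C)^-1).
    by apply/funext => y; rewrite /rotated mulic.
  move=> /(_ hx) h; apply: abs_continuousM.
  exact: (@abs_continuousN _ _ _ (fun y => w (y +i* x))).
Qed.

(** Both [dz] and [dzbar] are multiplied by factors of the same modulus, so the same bound [k]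
    serves. *)
Lemma quasiconformal_on_rotated (R : realType) (U : set R[i]) (w : R[i] -> R[i]) :
  quasiconformal_on [set z | U (- 'i%C * z)] w -> quasiconformal_on U (rotated w).
Proof.
move=> [hacl [k k01 hk]]; split; first exact: ACL_rotated.
exists k => //; move: (ae_plane_rotate hk).
apply: (@filterS _ _ (ae_filter_ringOfSetsType _)) => p.
move: (p.1 +i* p.2) => z h hU.
have {h} [] := h; first by rewrite /= mulrA mulNr -expr2 sqr_i opprK mul1r.
move=> hp hle; split; first by have [] := rotated_partials hp.
rewrite rotated_dz // rotated_dzbar //.
move: (dz _ _) (dzbar _ _) (_^-1) hle => u v l hle.
rewrite !normcM normcN normci !mul1r mulrA.
by rewrite ler_wpM2r // normc_ge0.
Qed.

Lemma open_normc_lt (R : realType) (r : R) : 0 < r ->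
  open [set z : R[i] | normc z < r].
Proof.
move=> r0; have -> : [set z : R[i] | normc z < r] = ball (0 : R[i]) (r%:C : R[i]).
  apply/seteqP; split=> z /=; rewrite -ball_normE /= sub0r normrN -ltcR;
    exact.
by apply: ball_open; rewrite ltcR.
Qed.

(** * The rotated map as a normalized solution *)

Lemma mulr_complex_continuous (R : realType) (k : R[i]) :
  continuous (fun z : R[i] => k * z).
Proof. exact: (@mulrl_continuous R[i] k). Qed.

Lemma homeomorphism_rotated (R : realType) (w : R[i] -> R[i]) :
  w 'i%C != 0 -> homeomorphism w -> homeomorphism (rotated w).
Proof.
move=> wi0 [v [cw cv wK vK]].
(* Obtained by solving w (i z) / w i = u for [z]. *)
exists (fun z => - 'i%C * v (w 'i%C * z)); split.
- have -> : rotated w = (fun z => (w 'i%C)^-1 * z) \o (w \o (fun z => 'i%C * z)).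
    by apply/funext => z /=; rewrite mulrC.
  move=> z; apply: continuous_comp; last exact: mulr_complex_continuous.
  by apply: continuous_comp; [exact: mulr_complex_continuous|exact: cw].
- move=> z; apply: (@continuous_comp _ _ _ (fun z => v (w 'i%C * z)) (fun z => - 'i%C * z));
    last exact: mulr_complex_continuous.
  by apply: continuous_comp; [exact: mulr_complex_continuous|exact: cv].
- move=> z; rewrite /rotated mulrCA divff // mulr1 wK mulrA mulNr -expr2.
  by rewrite sqr_i opprK mul1r.
- move=> z; rewrite /rotated mulrA mulrN -expr2 sqr_i opprK mul1r vK.
  by rewrite mulrAC divff // mul1r.
Qed.

Lemma normalized_solution_i_neq0 (R : realType) (mu w : R[i] -> R[i]) :
  normalized_solution mu w -> w 'i%C != 0.
Proof.
case=> -[v [_ _ wK _]] _ _ w0 _; apply/eqP => wi.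
have : 'i%C = 0 :> R[i] by rewrite -(wK 'i%C) wi -w0 wK.
by case=> /eqP; rewrite oner_eq0.
Qed.

(** The relation between [mu] and [nu] is asked only almost everywhere, because for grid
    coefficients it is established off the grid lines. *)
Lemma normalized_solution_rotated (R : realType) (mu nu w : R[i] -> R[i]) :
  ae_plane (fun z => nu z = - mu ('i%C * z)) ->
  normalized_solution mu w -> normalized_solution nu (rotated w).
Proof.
move=> hnu sol; have wi0 := normalized_solution_i_neq0 sol.
case: sol => hw qcw belw w0 w1.
split.
- exact: homeomorphism_rotated.
- move=> U oU [M hM]; apply/quasiconformal_on_rotated/qcw.
    have := (@continuousP _ _ _).1 (@mulr_complex_continuous R (- 'i%C)) U oU.
    exact.
  exists M => z /hM; rewrite normcM normcN.
  by rewrite normci mul1r.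
(* Partials are granted only on bounded open sets; exhausting the plane by countably many discs
   gives them almost everywhere. *)
- have hp : ae_plane (has_partials w).
    pose B n : set R[i] := [set z | normc z < n.+1%:R].
    have hB n : ae_plane (fun z => B n z -> has_partials w z).
      have [] := qcw (B n).
      - exact: open_normc_lt.
      - by exists n.+1%:R => z /ltW.
      - move=> _ [k _].
        by apply: (@filterS _ _ (ae_filter_ringOfSetsType _)) => p + hp => /(_ hp)[].
    have := ae_foralln hB.
    apply: (@filterS _ _ (ae_filter_ringOfSetsType _)) => p h.
    apply: (h (Num.bound (normc (p.1 +i* p.2)))).
    apply: (lt_trans (archi_boundP (normc_ge0 _))).
    by rewrite ltr_nat.
  move: (ae_plane_rotate hp) (ae_plane_rotate belw) hnu.
  apply: (@filterS3 _ _ (ae_filter_ringOfSetsType _)) => p h1 h2 ->.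
  rewrite rotated_dz // rotated_dzbar // h2; ring.
- by rewrite /rotated mulr0 w0 mul0r.
- by rewrite /rotated mulr1 divff.
Qed.


(** * Rotating the random coefficient *)

(** The interval from n to n + 1 is reflected to the one from - n - 1 to - n, so the lower corner
    acquires - n - 1. *)
Definition rotate_cell (c : cell) : cell := (- c.2 - 1, c.1).

Lemma rotate_cell_inj : injective rotate_cell.
Proof. by move=> [m n] [m' n'] [] /addIr /oppr_inj -> ->. Qed.

Lemma floorN_notint (R : realType) (x : R) : ~ range (intr : int -> R) x ->
  Num.floor (- x) = - Num.floor x - 1.
Proof.
move=> hx; apply: floor_def.
have /andP[h1 h2] := floor_itv x.
have h3 : (Num.floor x)%:~R != x by apply/eqP => e; apply: hx; exists (Num.floor x).
have h4 : (Num.floor x)%:~R < x by rewrite lt_neqAle h3.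
move: h2; rewrite !intrD !intrN => h2.
by apply/andP; split; lra.
Qed.

(** A turned cell contains its right edge instead of its left one. The mismatch arises only where
    [Im z] is a multiple of [delta]. *)
Lemma cell_of_rotate (R : realType) (delta : R) (z : R[i]) :
  ~ range (fun n : int => n%:~R * delta) (complex.Im z) -> delta != 0 ->
  cell_of delta ('i%C * z) = rotate_cell (cell_of delta z).
Proof.
case: z => x y /= hy d0; rewrite mulic /cell_of /rotate_cell /= mulNr.
rewrite floorN_notint // => -[n _ nE]; apply: hy; exists n => //.
by rewrite nE divfK.
Qed.

Definition rotate_config (R : realType) (omega : config R) : config R :=
  fun c => disk_opp (omega (rotate_cell c)).

Lemma grid_coef_rotate (R : realType) (delta : R) (omega : config R) : delta != 0 ->
  ae_plane (fun z => grid_coef delta (rotate_config omega) z =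
                     - grid_coef delta omega ('i%C * z)).
Proof.
move=> d0.
have : countable (range (fun n : int => n%:~R * delta)).
  by apply: (sub_countable (card_image_le _ _)); exact: countableP.
move=> /ae_plane_Im_notin.
apply: (@filterS _ _ (ae_filter_ringOfSetsType _)) => p hp.
by rewrite /grid_coef cell_of_rotate.
Qed.

(** * Measurability of the rotation and invariance of the product law *)

Lemma measurable_disk_opp (R : realType) :
  measurable_fun setT (@disk_opp R : borel_disk R -> borel_disk R).
Proof.
apply: (@measurability _ _ (borel_disk R) (borel_disk R) _ _ _ erefl) => //.
move=> _ [_ [U oU <-] <-]; rewrite setTI.
apply: sub_sigma_algebra; exists (-%R @^-1` U) => //.
have cN : continuous (-%R : R[i] -> R[i]) by exact: opp_continuous.
exact: (@continuousP _ _ _).1 cN U oU.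
Qed.

Definition cylinder (R : realType) (F : seq cell) (B : cell -> set (borel_disk R)) :
  set (config R) := [set omega | forall c, c \in F -> B c (omega c)].

(** A generating family on which [iid_law] prescribes the measure and which, unlike the
    single-coordinate events defining [config], is stable under intersection. *)
Definition cylinders (R : realType) : set (set (config R)) :=
  [set C | exists F B, [/\ uniq F, forall c, measurable (B c) & C = @cylinder R F B]].

Lemma measurable_coordinate (R : realType) (c : cell) (B : set (borel_disk R)) :
  measurable B -> measurable [set omega : config R | B (omega c)].
Proof. by move=> mB; apply: sub_sigma_algebra; exists c, B. Qed.

Lemma measurable_cylinder (R : realType) (F : seq cell) (B : cell -> set (borel_disk R)) :
  (forall c, measurable (B c)) -> measurable (cylinder F B).
Proof.
move=> mB; rewrite (_ : cylinder F B =
    \big[setI/setT]_(c <- F) [set omega : config R | B c (omega c)]).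
  by apply: bigsetI_measurable => c _; exact: measurable_coordinate.
elim: F => [|c F IH]; first by rewrite big_nil; apply/seteqP; split.
rewrite big_cons -IH; apply/seteqP; split => omega /= h.
  split; first by apply: h; rewrite mem_head.
  by move=> c' hc'; apply: h; rewrite inE hc' orbT.
move=> c'; rewrite inE => /orP[/eqP ->|]; [exact: h.1|exact: h.2].
Qed.

Lemma cylinders_setI (R : realType) : setI_closed (@cylinders R).
Proof.
move=> _ _ [F1 [B1 [u1 m1 ->]]] [F2 [B2 [u2 m2 ->]]].
exists (undup (F1 ++ F2)).
(* A cell absent from one list gets the trivial constraint [setT] from it. *)
exists (fun c => (if c \in F1 then B1 c else setT) `&` (if c \in F2 then B2 c else setT)).
split; first exact: undup_uniq.
  by move=> c; apply: measurableI; case: ifP.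
apply/seteqP; split => omega /=.
  move=> [h1 h2] c _; split; case: ifP => // hc; [exact: h1|exact: h2].
move=> h; split => c hc.
- by have := h c; rewrite mem_undup mem_cat hc /= => /(_ isT)[].
- by have := h c; rewrite mem_undup mem_cat hc orbT /= => /(_ isT)[].
Qed.

Lemma measurable_config (R : realType) :
  @measurable _ (config R) = <<s @cylinders R >>.
Proof.
apply/seteqP; split.
  apply: smallest_sub; first exact: smallest_sigma_algebra.
  move=> _ [c [B [mB ->]]]; apply: sub_sigma_algebra.
  exists [:: c], (fun=> B); split => //.
  apply/seteqP; split => omega /=; last by apply; rewrite mem_head.
  by move=> h c'; rewrite inE => /eqP ->.
apply: smallest_sub; first exact: sigma_algebra_measurable.
by move=> _ [F [B [_ mB ->]]]; exact: measurable_cylinder.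
Qed.

Lemma measurable_rotate_config (R : realType) :
  measurable_fun setT (@rotate_config R).
Proof.
apply: (@measurability _ _ (config R) (config R) _ _ _ erefl) => //.
move=> _ [_ [c [B [mB ->]]] <-]; rewrite setTI.
apply: (@measurable_coordinate R (rotate_cell c) (@disk_opp R @^-1` B)).
by rewrite -[X in measurable X]setTI; exact: measurable_disk_opp.
Qed.

(** By uniqueness of measures it suffices to compare on cylinders. There the rotation only relabels
    cells injectively and negates the constraints, which [lambda] does not see. *)
Lemma rotate_config_preserves (R : realType) (lambda : probability (borel_disk R) R)
    (P : probability (config R) R) :
  (forall B : set (borel_disk R), measurable B ->
     lambda (@disk_opp R @^-1` B) = lambda B) ->
  iid_law lambda P ->
  forall E, measurable E -> P (@rotate_config R @^-1` E) = P E.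
Proof.
move=> lambda_sym hP E mE; apply/esym.
apply: (@measure_unique _ R (config R) (@cylinders R) (fun=> setT)
  (measurable_config R) (@cylinders_setI R) _ _ P
  (pushforward P (@rotate_config R)) _ _ E mE).
(* The exhausting sequence is constantly the whole space, the cylinder over no cell. *)
- move=> _; exists [::], (fun=> setT); split => //.
  by apply/seteqP; split.
- by apply/seteqP; split => // x _; exists 0%N.
- exact: measurable_rotate_config.
- move=> ? _ [F [B [uF mB ->]]]; rewrite /= /pushforward hP //.
  (* The inverse quarter turn on cells; it carries the constraint at [c] to the rotated cell. *)
  pose r c : cell := (c.2, - c.1 - 1).
  have rK c : r (rotate_cell c) = c.
    by case: c => m n; rewrite /r /rotate_cell /=; congr (_, _); lia.
  pose B' c := @disk_opp R @^-1` B (r c).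
  have -> : rotate_config (R:=R) @^-1` cylinder F B = cylinder (map rotate_cell F) B'.
    apply/seteqP; split => omega /= h c.
      by case/mapP => c' hc' ->; rewrite /B' rK; exact: h.
    by move=> hc; have := h _ (map_f rotate_cell hc); rewrite /B' rK.
  rewrite hP; last 2 first.
  + by rewrite map_inj_uniq //; exact: rotate_cell_inj.
  + by move=> c; rewrite -[X in measurable X]setTI; exact: measurable_disk_opp.
  rewrite big_map; apply: eq_bigr => c _.
  by rewrite /B' lambda_sym // rK.
- by move=> _; apply: (le_lt_trans (probability_le1 P measurableT)); exact: ltry.
Qed.

(** * The limit map *)

(** Conjugation has [dz] equal to 0 and [dzbar] equal to 1, so the equation reads 1 = 0 at every
    point, and the plane is not a null set. *)
Lemma conj_not_beltrami (R : realType) (m : R[i]) (A : R[i] -> R[i]) :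
  (forall z, A z = z^*%C) -> ~ ae_plane (fun z => dzbar A z = m * dz A z).
Proof.
move=> hA hae.
have dA (z : R[i]) : dx A z = 1 /\ dy A z = - 'i%C.
  split.
  - apply: dxE; split; under eq_fun do rewrite hA /=.
    + exact: is_derive_id.
    + exact: is_derive_cst.
  - apply: dyE; split; under eq_fun do rewrite hA /=.
    + by rewrite /= oppr0; exact: is_derive_cst.
    + exact: is_deriveNid.
have hne z : dzbar A z <> m * dz A z.
  have [e1 e2] := dA z; rewrite /dz /dzbar e1 e2 !mulrN -expr2 sqr_i opprK.
  rewrite subrr mul0r mulr0 divff ?pnatr_eq0 //.
  by move/eqP; rewrite oner_eq0.
move: hae => [N [mN N0 hN]].
have NT : N = setT by apply/seteqP; split => // p _; apply: hN; exact: hne.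
move: N0; rewrite NT -setXTT product_measure1E //.
have hT : lebesgue_measure [set: measurableTypeR R] = +oo%E.
  by have := @lebesgue_measure_itv R `]-oo, +oo[; rewrite set_itvNyy.
by rewrite [X in (X * _)%E]hT [X in (_ * X)%E]hT mulyy.
Qed.

(** [E] and its preimage under the rotation have equal probability above 1/2, so they cannot be
    disjoint. *)
Lemma coupled_rotation (R : realType) (lambda : probability (borel_disk R) R)
    (lambda_sym : forall B : set (borel_disk R), measurable B ->
       lambda (@disk_opp R @^-1` B) = lambda B)
    (P : probability (config R) R) (E : set (config R)) :
  iid_law lambda P -> measurable E -> ((2^-1)%:E < P E)%E ->
  exists2 omega, E omega & E (rotate_config omega).
Proof.
move=> hP mE hE; apply: contrapT => hno.
pose E' := @rotate_config R @^-1` E.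
have mE' : measurable E'.
  by rewrite -[X in measurable X]setTI; exact: measurable_rotate_config.
have disj : E `&` E' = set0.
  by apply/seteqP; split => // omega [h1 h2]; apply: hno; exists omega.
have := probability_le1 P (measurableU _ _ mE mE').
rewrite measureU // [X in (_ + X)%E](rotate_config_preserves lambda_sym hP mE) leNgt => /negP; apply.
have -> : 1%E = ((2^-1)%:E + (2^-1)%:E : \bar R)%E by rewrite -EFinD; congr _%:E; lra.
exact: lteD.
Qed.

Lemma rotated_close (R : realType) (lambda : probability (borel_disk R) R)
    (lambda_sym : forall B : set (borel_disk R), measurable B ->
       lambda (@disk_opp R @^-1` B) = lambda B)
    (A : R[i] -> R[i]) (hA : is_A_lambda lambda A) (e : R) : 0 < e -> e < 2^-1 ->
  exists w : R[i] -> R[i], [/\ w 'i%C != 0, normc (w 'i%C - A 'i%C) < e,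
    normc (w (-1) - A (-1)) < e & normc (w (-1) / w 'i%C - A 'i%C) < e].
Proof.
move=> e0 e2; case: hA => _ _ [P hP hA].
pose K : set R[i] := [set 'i%C; -1].
have cK : compact K by apply: finite_compact; exact: finite_set2.
have hsup (w : R[i] -> R[i]) : sup [set normc (w z - A z) | z in K] < e ->
    normc (w 'i%C - A 'i%C) < e /\ normc (w (-1) - A (-1)) < e.
  move=> hs; pose S := [set normc (w z - A z) | z in K].
  (* [sup] dominates the elements only of a set bounded above; the sum of the two values is such a
     bound. *)
  have ubS : has_ubound S.
    exists (normc (w 'i%C - A 'i%C) + normc (w (-1) - A (-1))).
    by move=> _ [z [->|->] <-]; rewrite ?lerDl ?lerDr normc_ge0.
  by split; apply: le_lt_trans hs; apply: ub_le_sup => //;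
    [exists 'i%C => //; left|exists (-1) => //; right].
have near_d := hA K e cK e0.
have [delta [d0 [E [mE hE hw]]]] :=
  @filter_ex _ ((0 : R)^'+) _ _ (filterI (nbhs_right_gt (0 : R)) near_d).
have hE2 : ((2^-1)%:E < P E)%E.
  by apply: lt_le_trans hE; rewrite lte_fin; lra.
have [omega E1 E2] := coupled_rotation lambda_sym hP mE hE2.
have [w [w1 _] /hsup[hi h1]] := hw _ E1.
have [w' [_ w'1] /hsup[hi' _]] := hw _ E2.
have d0' : delta != 0 by rewrite gt_eqF.
(* Uniqueness for the rotated coefficient identifies [w'] with [rotated w], whose value at i is w
   (-1) / w i. *)
have eqw := w'1 _ (normalized_solution_rotated (grid_coef_rotate omega d0') w1).
exists w; split => //.
- exact: normalized_solution_i_neq0 w1.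
- by move: hi'; rewrite -eqw /rotated -expr2 sqr_i.
Qed.

Theorem corollary1p2 (R : realType) (lambda : probability (borel_disk R) R)
    (lambda_sym : forall B : set (borel_disk R), measurable B ->
       lambda (@disk_opp R @^-1` B) = lambda B)
    (A : R[i] -> R[i]) (hA : is_A_lambda lambda A) :
  forall z : R[i], A z = z.
Proof.
have close := rotated_close lambda_sym hA.
case: hA => -[a [b [c hA']]] [m _ [[_ _ hbel A0 A1] _]] _.
have hAff z : A z = a * z + b * z^*%C + c by rewrite hA'.
have c0 : c = 0 by move: A0; rewrite hAff conjc0 !mulr0 !add0r.
have ab : a + b = 1 by move: A1; rewrite hAff conjc1 !mulr1 c0 addr0.
have AN1 : A (-1) = -1.
  by rewrite hAff (_ : (-1)^*%C = -1) ?rmorphN1 // c0 addr0 !mulrN1 -opprD ab.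
have Ai : A 'i%C = (a - b) * 'i%C.
  rewrite hAff c0 addr0 (_ : 'i%C^*%C = - 'i%C) ?mulrN ?mulrBl //.
  by apply/eqP; rewrite eq_complex /= oppr0 !eqxx.
have sq : A 'i%C ^+ 2 + 1 = 0.
  apply: eq0_normc; apply/eqP; rewrite eq_le normc_ge0 andbT.
  apply/ler_addgt0Pr => e e0; rewrite add0r.
  move: close; set u := A 'i%C => close; pose n := normc u.
  have n0 : 0 <= n by exact: normc_ge0.
  (* The bound 1/4 makes [rotated_close] applicable and gives |p - u| at most 1; the other bound is
     fitted to the total error d + d n + d + d n. *)
  pose d := Num.min (4^-1) (e / (2 * n + 2)).
  have d0 : 0 < d.
    by rewrite lt_min invr_gt0 ltr0n /= divr_gt0 //; lra.
  have d4 : d <= 4^-1 by rewrite ge_min lexx.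
  have de : d * (2 * n + 2) <= e.
    by rewrite -ler_pdivlMr; [rewrite ge_min lexx orbT|lra].
  have d2 : d < 2^-1 by lra.
  have [w [wi0 h1 h2 h3]] := close d d0 d2.
  set p := w 'i%C in wi0 h1 h3.
  set q := w (-1) in h2 h3.
  rewrite AN1 opprK in h2.
  (* Here [q] = (q / p) p is expanded with both factors close to [u], while [q] itself is close to
     -1. *)
  have -> : u ^+ 2 + 1 = (q + 1) - ((q / p - u) * u + (q / p - u) * (p - u) + u * (p - u)).
    by field.
  have t1 : normc ((q / p - u) * u) <= d * n.
    by rewrite normcM ler_wpM2r // ltW.
  have t2 : normc (u * (p - u)) <= d * n.
    by rewrite normcM mulrC ler_wpM2r // ltW.
  have t3 : normc ((q / p - u) * (p - u)) <= d * 1.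
    rewrite normcM ler_pM ?normc_ge0 // ltW //.
    by apply: lt_le_trans h1 _; lra.
  have tri (x y : R[i]) := le_normcD x y.
  apply: le_trans (tri _ _) _; rewrite normcN.
  have := tri ((q / p - u) * u + (q / p - u) * (p - u)) (u * (p - u)).
  have := tri ((q / p - u) * u) ((q / p - u) * (p - u)).
  lra.
(* Since [A i] = (a - b) i, its square being -1 means (a - b)^2 = 1; with a + b = 1 only the
   identity and the conjugation remain. *)
have : (a - b - 1) * (a - b + 1) = 0.
  move: sq; rewrite Ai exprMn sqr_i mulrN1 => sq.
  have -> : (a - b - 1) * (a - b + 1) = - (- (a - b) ^+ 2 + 1) by ring.
  by rewrite sq oppr0.
move/eqP; rewrite mulf_eq0 => /orP[] /eqP h.
- have b0 : b = 0.
    have : 2 * b = (a + b - 1) - (a - b - 1) by ring.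
    rewrite h ab !subrr.
    by move/eqP; rewrite mulf_eq0 pnatr_eq0 /= => /eqP.
  move=> z; rewrite hAff b0 c0 mul0r !addr0.
  by move: ab; rewrite b0 addr0 => ->; rewrite mul1r.
- have a0 : a = 0.
    have : 2 * a = (a + b - 1) + (a - b + 1) by ring.
    rewrite h ab subrr addr0.
    by move/eqP; rewrite mulf_eq0 pnatr_eq0 /= => /eqP.
  case: (@conj_not_beltrami R m A _ hbel) => z.
  by rewrite hAff a0 c0 mul0r add0r addr0; move: ab; rewrite a0 add0r => ->; rewrite mul1r.
Qed.
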